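(* Let $g\colon\mathbb{R}^n\to(-\infty,+\infty]$ be proper, convex and lower semicontinuous, $A\in\mathbb{R}^{m\times n}$, $b\in\mathbb{R}^m$, $f(x)=\frac12\|Ax-b\|^2$. Assume the problem $\min_x g(x)$ s.t. $Ax=b$ is feasible and that strong duality holds for it; let $(x^*,y^* )\in\mathbb{R}^n\times\mathbb{R}^m$ be any saddle point of $\min_x\max_y\; g(x)+\langle Ax,y\rangle-\langle b,y\rangle$, and let $g_*=g(x^* )$ be the optimal value. Let $\tau,\sigma>0$, $\lambda=\tau\sigma$ with $\lambda\|A\|^2<1$, let $x^0\in\mathbb{R}^n$, $s^0=x^0$, and for $k\ge0$ let $$z^k=\frac{x^k+ks^k}{k+1},\qquad x^{k+1}=\operatorname{prox}_{\tau g}\bigl(x^k-(k+1)\lambda\nabla f(z^k)\bigr),\qquad s^{k+1}=\frac{x^{k+1}+ks^k}{k+1}.$$ Put $D_x=\|x^0-x^*\|$ and $D_y=\|y^*\|$. Then for all $k\ge1$ $$\|As^k-b\|\le\frac{D_y+\sqrt{D_y^2+\sigma D_x^2/\tau}}{\sigma k}$$ and $$-\frac{D_y^2+D_y\sqrt{D_y^2+\sigma D_x^2/\tau}}{\sigma k}\le g(s^k)-g_*\le\frac{D_x^2}{2\tau k}.$$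
   Context: $\|\cdot\|$ is the Euclidean norm (operator norm for $A$); $\operatorname{prox}_{\tau g}(z)=\operatorname{argmin}_x\{\tau g(x)+\frac12\|x-z\|^2\}$; $\nabla f(x)=A^\top(Ax-b)$. Strong duality is understood as the existence of a saddle point. *)

(* Defs.v *)
From HB Require Import structures.
From mathcomp Require Import all_boot all_order all_algebra.
From mathcomp Require Import all_classical all_reals all_analysis.
From mathcomp Require Import ring.

Set Implicit Arguments.
Unset Strict Implicit.
Unset Printing Implicit Defensive.

Import Order.TTheory GRing.Theory Num.Theory.
Import numFieldNormedType.Exports.

Local Open Scope classical_set_scope.
Local Open Scope ring_scope.

Definition dot (R : realType) (n : nat) (u v : 'cV[R]_n) : R :=
  \sum_(i < n) u i 0 * v i 0.

(* The library norm on matrices is the sup norm, hence a separate Euclidean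
   norm; both induce the topology used by lower_semicontinuous. *)
Definition enorm (R : realType) (n : nat) (u : 'cV[R]_n) : R :=
  Num.sqrt (dot u u).

Definition opnorm (R : realType) (m n : nat) (A : 'M[R]_(m, n)) : R :=
  sup [set enorm (A *m u) | u in [set u : 'cV[R]_n | enorm u <= 1]].

Definition proper_efun (R : realType) (n : nat) (g : 'cV[R]_n -> \bar R) : Prop :=
  (forall x, (-oo < g x)%E) /\ (exists x, (g x < +oo)%E).

(* Meant for g > -oo, so that no indeterminate sum arises; at t = 0 and t = 1
   the library convention 0 * +oo = 0 makes the inequality trivial. *)
Definition convex_efun (R : realType) (n : nat) (g : 'cV[R]_n -> \bar R)
    : Prop :=
  forall (x y : 'cV[R]_n) (t : R), 0 <= t <= 1 ->
    (g (t *: x + (1 - t) *: y)%R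
       <= t%:E * g x + (1 - t)%R%:E * g y)%E.

Definition argmin (T : Type) (R : realType) (F : T -> \bar R) : set T :=
  [set x | forall y, (F x <= F y)%E].

(* The minimizer exists and is unique for g proper, convex and lower
   semicontinuous and tau > 0; the default value 0 is then irrelevant. *)
Definition prox (R : realType) (n : nat) (tau : R) (g : 'cV[R]_n -> \bar R)
    (z : 'cV[R]_n) : 'cV[R]_n :=
  xget 0 (argmin (fun x =>
    (tau%:E * g x + (2^-1 * enorm (x - z) ^+ 2)%R%:E)%E)).

Definition lsq (R : realType) (m n : nat) (A : 'M[R]_(m, n)) (b : 'cV[R]_m)
    (x : 'cV[R]_n) : R :=
  2^-1 * enorm (A *m x - b) ^+ 2.

Definition gradient (R : realType) (n : nat) (f : 'cV[R]_n -> R)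
    (x : 'cV[R]_n) : 'cV[R]_n :=
  \col_(i < n) 'D_(delta_mx i 0) f x.

Definition lagrangian (R : realType) (m n : nat) (g : 'cV[R]_n -> \bar R)
    (A : 'M[R]_(m, n)) (b : 'cV[R]_m) (x : 'cV[R]_n) (y : 'cV[R]_m) : \bar R :=
  (g x + (dot (A *m x) y - dot b y)%R%:E)%E.

Definition saddle_point (R : realType) (m n : nat)
    (L : 'cV[R]_n -> 'cV[R]_m -> \bar R) (xs : 'cV[R]_n) (ys : 'cV[R]_m)
    : Prop :=
  forall (x : 'cV[R]_n) (y : 'cV[R]_m),
    (L xs y <= L xs ys)%E /\ (L xs ys <= L x ys)%E.

Definition feasible (R : realType) (m n : nat) (g : 'cV[R]_n -> \bar R)
    (A : 'M[R]_(m, n)) (b : 'cV[R]_m) : Prop :=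
  exists x, (g x < +oo)%E /\ A *m x = b.

Lemma dotDl (R : realType) n (u v w : 'cV[R]_n) :
  dot (u + v) w = dot u w + dot v w.
Proof. by rewrite -big_split; apply: eq_bigr => i _; rewrite mxE mulrDl. Qed.

Lemma dotC (R : realType) n (u v : 'cV[R]_n) : dot u v = dot v u.
Proof. by apply: eq_bigr => i _; rewrite mulrC. Qed.

Lemma dotZl (R : realType) n a (u v : 'cV[R]_n) : dot (a *: u) v = a * dot u v.
Proof. by rewrite mulr_sumr; apply: eq_bigr => i _; rewrite mxE mulrA. Qed.

Lemma sqr_enorm (R : realType) n (u : 'cV[R]_n) : enorm u ^+ 2 = dot u u.
Proof. by rewrite sqr_sqrtr// sumr_ge0// => i _; rewrite -expr2 sqr_ge0. Qed.

Lemma lsqD (R : realType) m n (A : 'M[R]_(m, n)) b (x v : 'cV[R]_n) (h : R) :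
  lsq A b (h *: v + x) =
  lsq A b x + h * dot (A *m v) (A *m x - b) + h ^+ 2 * (2^-1 * dot (A *m v) (A *m v)).
Proof.
rewrite /lsq !sqr_enorm mulmxDr -scalemxAr -addrA.
move: (A *m v) (A *m x - b) => a r.
rewrite dotDl dotZl 2!(dotC _ (_ + _)) !dotDl !dotZl (dotC r a).
by field.
Qed.

Lemma gradientE (R : realType) m n (A : 'M[R]_(m, n)) b (x : 'cV[R]_n) :
  gradient (lsq A b) x = A^T *m (A *m x - b).
Proof.
apply/colP => i; rewrite [LHS]mxE.
set v := delta_mx i 0; set c := 2^-1 * dot (A *m v) (A *m v).
have -> : (A^T *m (A *m x - b)) i 0 = dot (A *m v) (A *m x - b).
  rewrite mxE; apply: eq_bigr => j _; rewrite -colE !mxE //.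
rewrite /derive.
set p := dot _ _.
apply/cvg_lim => //.
rewrite (_ : (fun h => _) = (fun h : R => h^-1 *: (h * p + h ^+ 2 * c))); last first.
  by apply/funext => h /=; rewrite lsqD; congr (_ *: _); rewrite -/p -/c; ring.
apply/cvgrPdist_le => /= e e0; near=> h.
have h0 : h != 0 by near: h; exact: nbhs_dnbhs_neq.
rewrite /GRing.scale /=.
rewrite (_ : p - _ = - (h * c)); last by field.
rewrite normrN.
near: h.
suff: (fun h : R => h * c) @ 0^' --> (0 * c).
  rewrite mul0r => /cvgrPdist_le => /(_ _ e0); by apply: filterS => h; rewrite sub0r normrN.
by apply: cvgMr_tmp; exact: cvg_within.
Unshelve. all: by end_near.
Qed.

(* Main.v *)
Require Import Defs.
From HB Require Import structures.
From mathcomp Require Import all_boot all_order all_algebra.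
From mathcomp Require Import all_classical all_reals all_analysis.
From mathcomp Require Import ring lra.

Import Order.TTheory GRing.Theory Num.Theory.
Import numFieldNormedType.Exports.

Local Open Scope classical_set_scope.
Local Open Scope ring_scope.

(** The scheme is a primal-dual method in disguise. Write r x = A x - b. As
k s^k is the sum of x^1, ..., x^k, the vector q^k = k r(s^k) is the sum of the
residuals r(x^1), ..., r(x^k), and the scaled gradient
(k+1) lambda grad f(z^k) equals lambda A^T (r(x^k) + q^k). Thus sigma q^k plays
the role of a dual iterate and the extrapolation is hidden in z^k.

The variational inequality of the prox step, tested at the saddle point xs
(where A xs = b), turns by pure expansion of scalar products into
[[
  tau (g(x^{k+1}) - g(xs)) + |x^{k+1} - xs|^2 / 2 + lambda |q^{k+1}|^2 / 2
    <= |x^k - xs|^2 / 2 + lambda |q^k|^2 / 2,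
]]
the error term lambda |A (x^{k+1} - x^k)|^2 being absorbed by
|x^{k+1} - x^k|^2 because lambda |A|^2 < 1 (prox_step_descent). Summing, and
using the convexity of g along the averages s^k (convex_running_average),
[[
  tau k (g(s^k) - g(xs)) + lambda k^2 |r(s^k)|^2 / 2 <= |x^0 - xs|^2 / 2.
]]
The saddle point gives g(s^k) - g(xs) >= - <r(s^k), ys> >= - Dy |r(s^k)|. These
two inequalities constitute a quadratic inequality for sigma k |r(s^k)|, whose
largest root gives the feasibility bound, and the other bounds follow
(convergence_bounds).

It remains to know that prox is indeed a minimizer. The saddle point
inequality L(xs, ys) <= L(x, ys) is an affine minorant of g, so the prox
objective has a bounded sublevel set, and a lower semicontinuous function
attains its minimum on a compact set (argmin_prox_nonempty). *)

(** * Euclidean geometry and the operator norm *)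

Section Euclid.
Context (R : realType).
Set Implicit Arguments.
Unset Strict Implicit.

Lemma dotDr n (u v w : 'cV[R]_n) : dot u (v + w) = dot u v + dot u w.
Proof. by rewrite dotC dotDl !(dotC _ u). Qed.

Lemma dotZr n a (u v : 'cV[R]_n) : dot u (a *: v) = a * dot u v.
Proof. by rewrite dotC dotZl (dotC v). Qed.

Lemma dotNl n (u v : 'cV[R]_n) : dot (- u) v = - dot u v.
Proof. by rewrite -scaleN1r dotZl mulN1r. Qed.

Lemma dotNr n (u v : 'cV[R]_n) : dot u (- v) = - dot u v.
Proof. by rewrite dotC dotNl (dotC v). Qed.

Lemma dot0r n (u : 'cV[R]_n) : dot u 0 = 0.
Proof. by rewrite -(scale0r 0) dotZr mul0r. Qed.

Lemma dot_ge0 n (u : 'cV[R]_n) : 0 <= dot u u.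
Proof. by rewrite -sqr_enorm sqr_ge0. Qed.

Lemma enorm_ge0 n (u : 'cV[R]_n) : 0 <= enorm u.
Proof. exact: sqrtr_ge0. Qed.

Lemma enorm0 n : enorm (0 : 'cV[R]_n) = 0.
Proof. by rewrite /enorm dot0r sqrtr0. Qed.

Lemma dot_trmx m n (A : 'M[R]_(m, n)) (u : 'cV[R]_m) (v : 'cV[R]_n) :
  dot (A^T *m u) v = dot u (A *m v).
Proof.
rewrite /dot; under eq_bigr do rewrite mxE mulr_suml.
rewrite exchange_big; apply: eq_bigr => i _; rewrite mxE mulr_sumr.
by apply: eq_bigr => j _; rewrite mxE; ring.
Qed.

Lemma sqr_coord_le n (u : 'cV[R]_n) i : u i 0 ^+ 2 <= dot u u.
Proof.
by rewrite /dot (bigD1 i)//= expr2 lerDl sumr_ge0// => j _; rewrite -expr2 sqr_ge0.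
Qed.

Lemma dot_eq0 n (u : 'cV[R]_n) : dot u u = 0 -> u = 0.
Proof.
move=> u0; apply/colP => i; rewrite mxE; apply/eqP.
by rewrite -sqrf_eq0 eq_le sqr_ge0 -{1}u0 sqr_coord_le.
Qed.

Lemma CauchySchwarz_dot n (u v : 'cV[R]_n) : dot u v <= enorm u * enorm v.
Proof.
have [v0|v_neq0] := eqVneq (dot v v) 0.
  by rewrite (dot_eq0 v0) dot0r mulr_ge0 ?enorm_ge0.
have vv : 0 < dot v v by rewrite lt_neqAle eq_sym v_neq0 dot_ge0.
rewrite -sqrtrM ?dot_ge0// (le_trans (ler_norm _))// -sqrtr_sqr ler_wsqrtr//.
have := dot_ge0 (dot v v *: u - dot u v *: v).
rewrite !(dotDl, dotDr, dotNl, dotNr, dotZl, dotZr) (dotC v u) => h.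
by rewrite -(ler_pM2l vv); lra.
Qed.

Lemma enormZ n a (u : 'cV[R]_n) : 0 <= a -> enorm (a *: u) = a * enorm u.
Proof.
by move=> a0; rewrite /enorm dotZl dotZr mulrA -expr2 sqrtrM ?sqr_ge0// sqrtr_sqr ger0_norm.
Qed.

Lemma enormN n (u : 'cV[R]_n) : enorm (- u) = enorm u.
Proof. by rewrite /enorm dotNl dotNr opprK. Qed.

(** Needed because sup is only meaningful on a nonempty bounded set; applying
the Cauchy-Schwarz inequality to each row bounds the image of the unit ball by
the Frobenius norm of A. *)
Lemma opnorm_has_sup m n (A : 'M[R]_(m, n)) :
  has_sup [set enorm (A *m u) | u in [set u : 'cV[R]_n | enorm u <= 1]].
Proof.
split.
  exists (enorm (A *m 0)); exists 0 => //=.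
  by rewrite enorm0 ler01.
exists (Num.sqrt (\sum_i dot (row i A)^T (row i A)^T)) => _ [u /= u1 <-].
rewrite ler_wsqrtr// ler_sum// => i _.
have -> : (A *m u) i 0 = dot (row i A)^T u.
  by rewrite mxE; apply: eq_bigr => j _; rewrite !mxE.
have := CauchySchwarz_dot (row i A)^T u.
have := CauchySchwarz_dot (- (row i A)^T) u.
rewrite dotNl enormN -sqr_enorm.
have := enorm_ge0 (row i A)^T; have := enorm_ge0 u.
set a := enorm (row i A)^T; set d := dot _ _; set e := enorm u => e0 a0 hN hP.
have ea : a * e <= a by rewrite ler_piMr.
by rewrite -expr2 -ler_sqrt ?sqr_ge0// !sqrtr_sqr (ger0_norm a0) ler_norml; lra.
Qed.

Lemma enorm_mulmx_le m n (A : 'M[R]_(m, n)) (u : 'cV[R]_n) :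
  enorm (A *m u) <= opnorm A * enorm u.
Proof.
have [u0|u_neq0] := eqVneq (enorm u) 0.
  rewrite (@dot_eq0 _ u) -?sqr_enorm ?u0 ?expr0n//.
  by rewrite mulmx0 !enorm0 mulr0.
have u_gt0 : 0 < enorm u by rewrite lt_neqAle eq_sym u_neq0 enorm_ge0.
rewrite -ler_pdivrMr// mulrC -enormZ ?invr_ge0 ?enorm_ge0// scalemxAr.
apply: ub_le_sup; first by case: (opnorm_has_sup A).
by exists ((enorm u)^-1 *: u) => //=; rewrite enormZ ?invr_ge0 ?enorm_ge0// mulVf.
Qed.

End Euclid.

(** * Existence of prox points and their variational inequality *)

Section Minimizers.
Context (R : realType).
Set Implicit Arguments.
Unset Strict Implicit.

(** The sets of points of K with F x <= F y, for y in K, are nested and hence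
form a filter base. A cluster point p of this filter is a minimizer: if
F y < a < F p for some y in K, the neighbourhood of p where F > a would miss
the set where F <= F y. *)
Lemma lsc_compact_min (T : topologicalType) (F : T -> \bar R) (K : set T) :
  lower_semicontinuous F -> compact K -> K !=set0 ->
  exists2 p, K p & forall x, K x -> (F p <= F x)%E.
Proof.
move=> lscF compK [x0 Kx0].
pose G : set_system T :=
  [set S | exists2 y, K y & forall x, K x -> (F x <= F y)%E -> S x].
have GF : ProperFilter G.
  apply: Build_ProperFilter_ex => [S [y Ky yS]|]; first by exists y; exact: yS.
  split; first by exists x0.
    move=> P Q [y Ky yP] [y' Ky' y'Q].
    have [yy'|y'y] := leP (F y) (F y').
      by exists y => // x Kx xy; split; [exact: yP|exact/y'Q/(le_trans xy)].
    by exists y' => // x Kx xy; split; [exact/yP/(le_trans xy)/ltW|exact: y'Q].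
  by move=> P Q PQ [y Ky yP]; exists y => // x Kx xy; exact/PQ/yP.
have [|p [Kp clp]] := compK G GF; first by exists x0.
exists p => // y Ky; rewrite leNgt; apply/negP => yp.
have [a ya ap] : exists2 a : R, (F y <= a%:E)%E & (a%:E < F p)%E.
  case: (F y) (F p) yp => [r| |] [q| |]//=; first by exists r.
  - by move=> _; exists r => //; rewrite ltry.
  - by move=> _; exists (q - 1); rewrite ?leNye// lte_fin ltrBlDr ltrDl.
  - by move=> _; exists 0; rewrite ?leNye// ltry.
have [V pV Va] := lscF _ _ ap.
have GS : G [set x | (F x <= F y)%E] by exists y.
have [x [/= xy /Va]] := clp _ _ GS pV.
by rewrite ltNge (le_trans xy ya).
Qed.

(** The closed balls of the sup norm, as the transposes of a product of
segments. *)
Lemma compact_cube n (z : 'cV[R]_n) (M : R) :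
  compact [set v : 'cV[R]_n | forall i, `|v i 0 - z i 0| <= M].
Proof.
pose I (i : 'I_n) : set R := `[z i 0 - M, z i 0 + M]%classic.
have -> : [set v : 'cV[R]_n | forall i, `|v i 0 - z i 0| <= M] =
    trmx @` [set v : 'rV[R]_n | forall i, I i (v ord0 i)].
  apply/seteqP; split => [v vM|_ [w wM <-]] /= => [|i].
    exists v^T; last exact: trmxK.
    by move=> i; rewrite /I /= mxE in_itv /=; have := vM i; rewrite ler_norml; lra.
  have := wM i; rewrite /I /= mxE in_itv /= ler_norml.
  rewrite (_ : 0 = ord0)//. lra.
apply: continuous_compact.
  apply: continuous_subspaceT => w S /= /(nbhs_ballP w^T)[e e0 eS].
  apply/nbhs_ballP; exists e => //= v [_ wv]; apply: eS; split => // i j.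
  by rewrite !mxE; exact: wv.
by apply: rV_compact => i; exact: segment_compact.
Qed.

Lemma half_sqr_dist_continuous n (z : 'cV[R]_n) :
  continuous (fun x : 'cV[R]_n => 2^-1 * enorm (x - z) ^+ 2 : R).
Proof.
have contz i : continuous (fun x : 'cV[R]_n => (x i 0 - z i 0) * (x i 0 - z i 0)).
  move=> x.
  have xiz : (fun y : 'cV[R]_n => y i 0 - z i 0) @ x --> x i 0 - z i 0.
    apply: (@cvgB R R^o _ (nbhs x) _ (fun y : 'cV[R]_n => y i 0) (fun=> z i 0)).
      exact: (@coord_continuous R n 1 i 0 x).
    exact: cvg_cst.
  exact: (cvgM xiz xiz).
have cont_sum : continuous (fun x : 'cV[R]_n =>
    \sum_(i < n) (x i 0 - z i 0) * (x i 0 - z i 0)).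
  exact: (@continuous_big R 'I_n +%R 0 xpredT (@add_continuous R)).
rewrite (_ : (fun _ => _) = fun x : 'cV[R]_n =>
    2^-1 * \sum_(i < n) (x i 0 - z i 0) * (x i 0 - z i 0)).
  by move=> x; apply: (@cvgMl_tmp _ _ (nbhs x)); exact: (cont_sum x).
apply/funext => x; rewrite sqr_enorm; congr (_ * _).
by apply: eq_bigr => i _; rewrite !mxE.
Qed.

(** A real bound a < tau * g x + h x leaves room for a real c < g x with
a < tau * c + h x; then g > c and a < tau * c + h both hold near x. *)
Lemma lsc_scaleD (T : topologicalType) (g : T -> \bar R) (h : T -> R) (tau : R) :
  0 < tau -> lower_semicontinuous g -> continuous h ->
  lower_semicontinuous (fun x => tau%:E * g x + (h x)%:E)%E.
Proof.
move=> tau0 lscg conth x a aF.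
have [c cg ac] : exists2 c : R, (c%:E < g x)%E & a < tau * c + h x.
  case: (g x) aF => [r| |] /=.
  - rewrite -EFinM -EFinD lte_fin => aF.
    have e0 : 0 < (tau * r + h x - a) / (2 * tau) by rewrite divr_gt0//; lra.
    exists (r - (tau * r + h x - a) / (2 * tau)); first by rewrite lte_fin; lra.
    suff -> : tau * (r - (tau * r + h x - a) / (2 * tau)) =
              tau * r - (tau * r + h x - a) / 2 by lra.
    by field; lra.
  - move=> _; exists ((a - h x + 1) / tau); first exact: ltry.
    by rewrite mulrCA divff ?gt_eqF// mulr1; lra.
  - by rewrite gt0_muleNy ?lte_fin// addNye ltNge leNye.
have [V xV Vc] := lscg _ _ cg.
exists (V `&` [set y | a < tau * c + h y]).
  apply: filterI => //.
  have := conth x => /cvgrPdist_lt /(_ (tau * c + h x - a)).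
  rewrite subr_gt0 ac => /(_ isT); apply: filterS => y /=.
  by rewrite ltr_norml => /andP[_]; lra.
move=> y [/Vc cy /= ay].
have: ((tau * c)%:E < tau%:E * g y)%E by rewrite EFinM lte_pmul2l.
case: (g y) cy => [r| |] // _.
  by rewrite -EFinM -EFinD !lte_fin; lra.
by rewrite gt0_muley ?lte_fin// addye// !ltry.
Qed.

(** Against an affine minorant of g with slope q, the quadratic term wins:
F x <= F u confines x to a cube around z, on which F attains its minimum. *)
Lemma argmin_prox_nonempty n (g : 'cV[R]_n -> \bar R) (tau c : R)
    (q z u : 'cV[R]_n) :
  lower_semicontinuous g -> 0 < tau -> (g u < +oo)%E ->
  (forall x, ((c + dot q x)%:E <= g x)%E) ->
  argmin (fun x =>
    (tau%:E * g x + (2^-1 * enorm (x - z) ^+ 2)%R%:E)%E) !=set0.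
Proof.
move=> lscg tau0 gu minor; set F := fun x => _.
have lscF : lower_semicontinuous F.
  by apply: lsc_scaleD => //; exact: half_sqr_dist_continuous.
have [w uw] : exists w : R, (F u = w%:E)%E.
  have := minor u; rewrite /F; case: (g u) gu => // r _ _.
  by exists (tau * r + 2^-1 * enorm (u - z) ^+ 2).
pose B := w - tau * (c + dot q z) + tau ^+ 2 * dot q q.
have cube x : (F x <= F u)%E -> forall i, `|x i 0 - z i 0| <= 1 + 4 * B.
  move=> Fxu i.
  have dB : 4^-1 * dot (x - z) (x - z) <= B.
    have : ((tau * (c + dot q x))%:E + (2^-1 * enorm (x - z) ^+ 2)%:E <= w%:E)%E.
      rewrite -uw; apply: le_trans Fxu; apply: leeD => //.
      by rewrite EFinM lee_pmul2l.
    rewrite -EFinD lee_fin sqr_enorm.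
    have -> : dot q x = dot q z + dot q (x - z) by rewrite dotDr dotNr; ring.
    (* Young's inequality: the linear term costs tau^2 |q|^2 and half of the
       quadratic term. *)
    have := dot_ge0 (tau *: q + 2^-1 *: (x - z)).
    rewrite !(dotDl (tau *: q), dotDr _ (tau *: q), dotZl, dotZr) (dotC (x - z) q).
    by rewrite /B; lra.
  have := sqr_coord_le (x - z) i; rewrite !mxE => hi.
  (* From d^2 <= 4 B and 2 d <= d^2 + 1, without square roots. *)
  have := sqr_ge0 (`|x i 0 - z i 0| - 1); rewrite sqrrB real_normK ?num_real//.
  have := normr_ge0 (x i 0 - z i 0).
  by rewrite mulr1 expr1n; lra.
have [] := lsc_compact_min lscF (@compact_cube n z (1 + 4 * B)).
  by exists u; exact: cube.
move=> p _ pmin; exists p => y.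
have [yu|/ltW uy] := leP (F y) (F u); first exact/pmin/cube.
by apply: le_trans uy; exact/pmin/cube.
Qed.

Lemma affine_const_ge0 (a c : R) : 0 <= c ->
  (forall t, 0 < t <= 1 -> 0 <= a + t * c) -> 0 <= a.
Proof.
move=> c0 h; rewrite leNgt; apply/negP => a0.
have ca : 0 < c - a by lra.
(* At this t the affine expression equals - a^2 / (c - a). *)
have := h (- a / (c - a)); rewrite divr_gt0 ?ler_pdivrMr ?oppr_gt0// mul1r.
have -> : - a <= c - a by lra.
move=> /(_ isT); apply/negP; rewrite -ltNge.
have -> : a + - a / (c - a) * c = - (a ^+ 2 / (c - a)) by field; lra.
by rewrite oppr_lt0 divr_gt0// exprn_even_gt0//= lt_eqF.
Qed.

(** Compare p with the points of the segment from p to u: after division by t,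
minimality and convexity give an inequality affine in t, whose value at t = 0
is the claim. *)
Lemma argmin_variational n (g : 'cV[R]_n -> \bar R) (tau : R)
    (z p u : 'cV[R]_n) :
  proper_efun g -> convex_efun g -> 0 < tau -> (g u < +oo)%E ->
  argmin (fun x =>
    (tau%:E * g x + (2^-1 * enorm (x - z) ^+ 2)%R%:E)%E) p ->
  (g p < +oo)%E /\
  tau * (fine (g p) - fine (g u)) <= dot (p - z) (u - p).
Proof.
move=> [gNy _] convg tau0 gu pmin.
have := pmin u.
have [] := (gNy u, gNy p).
case gpE: (g p) => [gp| |] //; case guE: (g u) gu => [gv| |] // _ _ _; last first.
  by rewrite gt0_muley ?lte_fin// addye// -EFinM -EFinD leNgt ltry.
move=> _; split; first exact: ltry.
rewrite /= -subr_ge0.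
have := dot_ge0 (u - p) => d0.
apply: (@affine_const_ge0 _ (2^-1 * dot (u - p) (u - p))); first by rewrite mulr_ge0.
move=> t /andP[t0 t1].
have tt : 0 <= t <= 1 by lra.
have := convg u p t tt; have := pmin (t *: u + (1 - t) *: p).
have := gNy (t *: u + (1 - t) *: p).
rewrite guE gpE -!EFinM -!EFinD; case: (g (t *: u + _)) => [r| |]// _.
rewrite -EFinM -EFinD !lee_fin !sqr_enorm.
have -> : t *: u + (1 - t) *: p - z = t *: (u - p) + (p - z).
  by apply/colP => i; rewrite !mxE; ring.
rewrite (dotDl (t *: _)) !(dotDr _ (t *: _)) !dotZl !dotZr (dotC (u - p)).
move: (dot _ _) (dot _ _) (dot _ _) => a e f h1 h2.
rewrite -(pmulr_rge0 _ t0).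
have : tau * r <= tau * (t * gv + (1 - t) * gp) by rewrite ler_pM2l.
lra.
Qed.
End Minimizers.

(** * The primal-dual iteration *)

Section PrimalDual.
Context (R : realType).
Set Implicit Arguments.
Unset Strict Implicit.

(** Finiteness of g xs comes from a feasible point; A xs = b because otherwise
moving ys along the residual A xs - b would increase the Lagrangian. *)
Lemma saddle_point_KKT m n (g : 'cV[R]_n -> \bar R) (A : 'M[R]_(m, n))
    (b : 'cV[R]_m) (xs : 'cV[R]_n) (ys : 'cV[R]_m) :
  (forall x, (-oo < g x)%E) -> feasible g A b ->
  saddle_point (lagrangian g A b) xs ys ->
  [/\ (g xs < +oo)%E, A *m xs = b &
      forall x, ((fine (g xs) - dot (A *m x - b) ys)%:E <= g x)%E].
Proof.
move=> gNy [x0 [gx0 Ax0]] sad.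
have gxs : (g xs < +oo)%E.
  have [_] := sad x0 ys; rewrite /lagrangian.
  have := gNy x0; case: (g x0) gx0 => // r _ _; rewrite -EFinD.
  by case: (g xs) => [c| |]//= _; exact: ltry.
have [c gxsE] : exists c, g xs = c%:E.
  by have := gNy xs; case: (g xs) gxs => // c _ _; exists c.
have Axs : A *m xs = b.
  apply/eqP; rewrite -subr_eq0; apply/eqP/dot_eq0/eqP.
  rewrite eq_le dot_ge0 andbT.
  have [+ _] := sad xs (ys + (A *m xs - b)).
  rewrite /lagrangian gxsE -!EFinD lee_fin.
  by rewrite !(dotDr _ ys) (dotDl (A *m xs)) (dotNl b); lra.
split=> // x.
have [_] := sad x ys; rewrite /lagrangian gxsE Axs /= subrr adde0 dotDl dotNl.
have := gNy x; case: (g x) => [r| |]// _; last by rewrite !leey.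
by rewrite -EFinD !lee_fin; lra.
Qed.

(** The decrease of the potential |x - u|^2 / 2 + lambda |q|^2 / 2, where q is
the sum of the past residuals and delta stands for tau (g(p) - g(u)). With
a = x - u, d = p - x, r = A a and e = A d, the difference of the two sides is
at least (|d|^2 + lambda |r|^2 - lambda |e|^2) / 2, and lambda |e|^2 <= |d|^2
by the step size condition. *)
Lemma prox_step_descent m n (A : 'M[R]_(m, n)) (b : 'cV[R]_m)
    (u x p : 'cV[R]_n) (q : 'cV[R]_m) (lambda delta : R) :
  0 <= lambda -> lambda * opnorm A ^+ 2 <= 1 -> A *m u = b ->
  delta <= dot (p - (x - lambda *: (A^T *m (A *m x - b + q)))) (u - p) ->
  delta + 2^-1 * dot (p - u) (p - u)
    + lambda / 2 * dot (A *m p - b + q) (A *m p - b + q)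
  <= 2^-1 * dot (x - u) (x - u) + lambda / 2 * dot q q.
Proof.
move=> lambda0 step Au; rewrite -Au -!mulmxBr.
pose a := x - u; pose d := p - x.
have -> : p - u = a + d by apply/colP => i; rewrite !mxE; ring.
have -> : u - p = - (a + d) by apply/colP => i; rewrite !mxE; ring.
rewrite -/a opprD opprK addrA -/d dotNr (dotDl d) dotZl dot_trmx (mulmxDr A a d).
clearbody a d.
have : lambda * dot (A *m d) (A *m d) <= dot d d.
  apply: le_trans (_ : lambda * (opnorm A ^+ 2 * dot d d) <= _).
    rewrite ler_wpM2l// -!sqr_enorm -exprMn lerXn2r ?nnegrE ?enorm_ge0//.
      exact: le_trans (enorm_ge0 _) (enorm_mulmx_le _ _).
    exact: enorm_mulmx_le.
  by rewrite mulrA ler_piMl ?dot_ge0.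
move: (A *m a) (A *m d) => r e.
have := mulr_ge0 lambda0 (dot_ge0 r).
rewrite !(dotDl, dotDr) (dotC d a) (dotC e r) (dotC q r) (dotC q e).
lra.
Qed.

(** For k = 0 the average is p itself and the value g s, possibly infinite, is
multiplied by zero, so finiteness of g s is only assumed for k > 0. *)
Lemma convex_running_average n (g : 'cV[R]_n -> \bar R) (k : nat)
    (p s : 'cV[R]_n) :
  (forall x, (-oo < g x)%E) -> convex_efun g -> (g p < +oo)%E ->
  ((0 < k)%N -> (g s < +oo)%E) ->
  let s' := k.+1%:R^-1 *: (p + k%:R *: s) in
  (g s' < +oo)%E /\
  k.+1%:R * fine (g s') <= fine (g p) + k%:R * fine (g s).
Proof.
move=> gNy convg gp gs /=.
case: k gs => [_|k /(_ isT) gs].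
  by rewrite invr1 scale1r scale0r addr0 mul1r mul0r addr0.
set K : R := k.+1%:R; have -> : k.+2%:R = K + 1 :> R by rewrite natr1.
have K0 : 0 < K by rewrite ltr0n.
have K1 : K + 1 != 0 by rewrite gt_eqF//; lra.
have -> : (K + 1)^-1 *: (p + K *: s) =
    (K + 1)^-1 *: p + (1 - (K + 1)^-1) *: s.
  by rewrite scalerDr scalerA; congr (_ + _ *: _); field.
have : 0 <= (K + 1)^-1 <= 1 by rewrite invr_ge0 invf_le1; lra.
move=> /(convg p s).
move: (_ + _ *: s) => s'.
have := gNy p; have := gNy s; have := gNy s'.
case: (g s') => [c''| |]//; case: (g s) gs => [c'| |]// _; case: (g p) gp => [c| |]// _ _ _ _.
  rewrite -!EFinM -EFinD lee_fin ltry /= => h; split => //.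
  have := ler_wpM2l (_ : 0 <= K + 1) h.
  have -> : (K + 1) * ((K + 1)^-1 * c + (1 - (K + 1)^-1) * c') = c + K * c'.
    by field.
  by apply; lra.
Qed.

(** With P = sigma k rho, the first inequality and delta >= - Dy rho combine to
(P - Dy)^2 <= Dy^2 + sigma Dx^2 / tau. Here delta is the objective gap and rho
the norm of the residual. *)
Lemma convergence_bounds (tau sigma k delta rho Dx Dy : R) :
  0 < tau -> 0 < sigma -> 0 < k -> 0 <= rho -> 0 <= Dy ->
  tau * (k * delta) + tau * sigma / 2 * (k * rho) ^+ 2 <= 2^-1 * Dx ^+ 2 ->
  - (Dy * rho) <= delta ->
  let Q := Num.sqrt (Dy ^+ 2 + sigma * Dx ^+ 2 / tau) in
  [/\ rho <= (Dy + Q) / (sigma * k),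
      - ((Dy ^+ 2 + Dy * Q) / (sigma * k)) <= delta &
      delta <= Dx ^+ 2 / (2 * tau * k)].
Proof.
move=> tau0 sigma0 k0 rho0 Dy0 upper lower Q.
have sk0 : 0 < sigma * k by rewrite mulr_gt0.
have rhoQ : rho <= (Dy + Q) / (sigma * k).
  rewrite ler_pdivlMr// -lerBlDl (le_trans (ler_norm _))// -sqrtr_sqr ler_wsqrtr//.
  have h : sigma / tau * (tau * (k * - (Dy * rho)) + tau * sigma / 2 * (k * rho) ^+ 2)
      <= sigma / tau * (2^-1 * Dx ^+ 2).
    rewrite ler_pM2l ?divr_gt0//; apply: le_trans upper.
    by rewrite lerD2r !ler_pM2l.
  have e : sigma / tau * (tau * (k * - (Dy * rho)) + tau * sigma / 2 * (k * rho) ^+ 2)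
      = ((rho * (sigma * k) - Dy) ^+ 2 - Dy ^+ 2) / 2 by field; lra.
  rewrite e in h.
  have e2 : sigma * Dx ^+ 2 / tau = 2 * (sigma / tau * (2^-1 * Dx ^+ 2)).
    by field; lra.
  by rewrite e2; lra.
split=> //.
  apply: le_trans lower; rewrite lerN2.
  have -> : (Dy ^+ 2 + Dy * Q) / (sigma * k) = Dy * ((Dy + Q) / (sigma * k)).
    by ring.
  exact: ler_wpM2l.
rewrite ler_pdivlMr ?mulr_gt0//.
have : 0 <= tau * sigma / 2 * (k * rho) ^+ 2.
  by rewrite mulr_ge0 ?sqr_ge0// divr_ge0// mulr_ge0 ?ltW.
by lra.
Qed.

End PrimalDual.

Theorem mainTheorem3 (R : realType) (m n : nat) (g : 'cV[R]_n -> \bar R)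
    (A : 'M[R]_(m, n)) (b : 'cV[R]_m)
    (xs : 'cV[R]_n) (ys : 'cV[R]_m) (tau sigma lambda : R)
    (x s z : nat -> 'cV[R]_n)
    (g_proper : proper_efun g)
    (g_convex : convex_efun g)
    (g_lsc : lower_semicontinuous g)
    (feas : feasible g A b)
    (saddle : saddle_point (lagrangian g A b) xs ys)
    (tau_gt0 : 0 < tau) (sigma_gt0 : 0 < sigma)
    (lambdaE : lambda = tau * sigma)
    (step : lambda * opnorm A ^+ 2 < 1)
    (s0 : s 0%N = x 0%N)
    (zE : forall k : nat, z k = k.+1%:R^-1 *: (x k + k%:R *: s k))
    (xE : forall k : nat,
       x k.+1 =
       prox tau g (x k - (k.+1%:R * lambda) *: gradient (lsq A b) (z k)))
    (sE : forall k : nat, s k.+1 = k.+1%:R^-1 *: (x k.+1 + k%:R *: s k)) :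
  let Dx := enorm (x 0%N - xs) in
  let Dy := enorm ys in
  let gs := g xs in
  forall k : nat, (1 <= k)%N ->
    [/\ enorm (A *m s k - b) <=
          (Dy + Num.sqrt (Dy ^+ 2 + sigma * Dx ^+ 2 / tau)) / (sigma * k%:R),
        ((- ((Dy ^+ 2 + Dy * Num.sqrt (Dy ^+ 2 + sigma * Dx ^+ 2 / tau))
             / (sigma * k%:R)))%R%:E <= g (s k) - gs)%E
      & (g (s k) - gs <= (Dx ^+ 2 / (2 * tau * k%:R))%R%:E)%E].
Proof.
have gNy := g_proper.1.
have [gxs Axs minor] := saddle_point_KKT gNy feas saddle.
have lambda0 : 0 < lambda by rewrite lambdaE mulr_gt0.
(* Applied both to z k and to s k.+1: residuals of averages are averages of
   residuals. *)
have avg_residual k (v w : 'cV[R]_n) :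
    k.+1%:R *: (A *m (k.+1%:R^-1 *: (v + k%:R *: w)) - b) =
    A *m v - b + k%:R *: (A *m w - b).
  rewrite -scalemxAr scalerBr scalerA divff ?pnatr_eq0// scale1r mulmxDr.
  by rewrite -scalemxAr -nat1r scalerDl scale1r scalerBr opprD addrACA.
have x_prox k : argmin (fun v => (tau%:E * g v + (2^-1 * enorm (v -
      (x k - lambda *: (A^T *m (A *m x k - b + k%:R *: (A *m s k - b))))) ^+ 2)%R%:E)%E)
    (x k.+1).
  rewrite xE gradientE zE (mulrC _ lambda) -scalerA (scalemxAr k.+1%:R) avg_residual.
  apply: xgetPex; apply: (@argmin_prox_nonempty _ _ g tau (fine (g xs) + dot b ys)
    (- (A^T *m ys)) _ xs) => // v.
  apply: le_trans (minor v); rewrite lee_fin dotNl dot_trmx dotDl dotNl.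
  by rewrite (dotC ys); lra.
(* The weight k vanishes at k = 0, where g (s 0) may be +oo. *)
have invariant k : ((0 < k)%N -> (g (s k) < +oo)%E) /\
    tau * (k%:R * (fine (g (s k)) - fine (g xs))) +
    2^-1 * dot (x k - xs) (x k - xs) +
    lambda / 2 * dot (k%:R *: (A *m s k - b)) (k%:R *: (A *m s k - b))
    <= 2^-1 * enorm (x 0%N - xs) ^+ 2.
  elim: k => [|k [gsk IH]].
    by rewrite mul0r scale0r dot0r mulr0 !mulr0 add0r addr0 sqr_enorm.
  have [gx vi] := argmin_variational g_proper g_convex tau_gt0 gxs (x_prox k).
  have [gs' avg] := convex_running_average gNy g_convex gx gsk.
  have desc := prox_step_descent (ltW lambda0) (ltW step) Axs vi.
  rewrite sE avg_residual; split => //.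
  have := ler_wpM2l (ltW tau_gt0) avg.
  by lra.
move=> Dx Dy gs k k1.
have [/(_ k1) gsk inv] := invariant k.
have k0 : 0 < k%:R :> R by rewrite ltr0n.
have lower : - (Dy * enorm (A *m s k - b)) <= fine (g (s k)) - fine (g xs).
  have := CauchySchwarz_dot (A *m s k - b) ys.
  have := minor (s k); rewrite -/Dy.
  by have := gNy (s k); case: (g (s k)) gsk => // r _ _; rewrite lee_fin /=; lra.
have upper : tau * (k%:R * (fine (g (s k)) - fine (g xs))) +
    tau * sigma / 2 * (k%:R * enorm (A *m s k - b)) ^+ 2 <= 2^-1 * Dx ^+ 2.
  rewrite -enormZ ?(ltW k0)// sqr_enorm -lambdaE; apply: (le_trans _ inv).
  by have := dot_ge0 (x k - xs); lra.
have [] := convergence_bounds tau_gt0 sigma_gt0 k0 (enorm_ge0 _) (enorm_ge0 _) upper lower.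
rewrite -/Dy => b1 b2 b3; split => //.
  move: b2; rewrite /gs; have := gNy (s k); have := gNy xs.
  by case: (g (s k)) gsk => // r _; case: (g xs) gxs => // c _ _ _ /=.
move: b3; rewrite /gs; have := gNy (s k); have := gNy xs.
by case: (g (s k)) gsk => // r _; case: (g xs) gxs => // c _ _ _ /=.
Qed.
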